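(* Let $T\subset \mathrm{Diff}^2_+(\mathbb S^1)$ be a semigroup without finite orbits in $\mathbb S^1$. Then the semigroup $T^{-1}=\{f^{-1}:f\in T\}$ has the same number of minimal sets as $T$.
   Context: $\mathrm{Diff}_+^2(\mathbb S^1)$ is the group of orientation-preserving $C^2$ circle diffeomorphisms. A minimal set of a semigroup $T$ is a nonempty closed set $K\subset\mathbb S^1$ with $f(K)\subset K$ for all $f\in T$, minimal for inclusion among such sets. *)

(* Defs.v *)
From HB Require Import structures.
From mathcomp Require Import all_boot all_order all_algebra generic_quotient.
From mathcomp Require Import all_classical all_reals all_analysis.
Import Order.TTheory GRing.Theory Num.Theory.
Import numFieldNormedType.Exports.

Set Implicit Arguments.
Unset Strict Implicit.
Unset Printing Implicit Defensive.

Local Open Scope classical_set_scope.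
Local Open Scope ring_scope.
Local Open Scope quotient_scope.

Definition congr_int (R : realType) : rel R := fun x y => x - y \is a Num.int.

Lemma congr_int_equiv (R : realType) : equiv_class_of (@congr_int R).
Proof.
rewrite /congr_int; split.
- by move=> x; rewrite subrr rpred0.
- by move=> x y; rewrite -opprB rpredN.
- move=> y x z xy yz.
  have -> : x - z = (x - y) + (y - z) by rewrite addrA subrK.
  exact: rpredD.
Qed.

Canonical congr_int_equivRel (R : realType) :=
  EquivRelPack (congr_int_equiv R).

Definition circle (R : realType) : topologicalType :=
  quotient_topology {eq_quot (congr_int_equivRel R)}.

Definition circle_pi (R : realType) : R -> circle R :=
  \pi_(quotient_topology {eq_quot (congr_int_equivRel R)}).

Definition is_lift (R : realType) (f : circle R -> circle R) (F : R -> R) :=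
  continuous F /\ forall x, f (circle_pi x) = circle_pi (F x).

Definition C2_fun (R : realType) (F : R -> R) :=
  [/\ forall x, derivable F x 1,
      forall x, derivable (F^`()%classic) x 1
    & continuous (F^`(2)%classic)].

(* As R -> R / Z is a smooth covering and R is simply connected, a circle map
   is C^2 exactly when it has a C^2 lift; all its continuous lifts differ by
   integer constants, so it does not matter which one is considered, either
   here or in the next definition. *)
Definition C2_circle_map (R : realType) (f : circle R -> circle R) :=
  exists2 F : R -> R, is_lift f F & C2_fun F.

Definition orientation_preserving (R : realType) (f : circle R -> circle R) :=
  exists2 F : R -> R, is_lift f F & {homo F : x y / x < y}.

Definition inverse_of (X : Type) (f g : X -> X) := cancel f g /\ cancel g f.

Definition Diff2_plus (R : realType) : set (circle R -> circle R) :=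
  [set f | [/\ C2_circle_map f, orientation_preserving f &
    exists2 g, inverse_of f g & C2_circle_map g]].

Definition semigroup (X : Type) (T : set (X -> X)) :=
  forall f g, T f -> T g -> T (f \o g).

Definition inverse_set (X : Type) (T : set (X -> X)) : set (X -> X) :=
  [set g | exists2 f, T f & inverse_of f g].

Definition orbit_of (X : Type) (T : set (X -> X)) (x : X) : set X :=
  [set f x | f in T].

Definition closed_invariant (X : topologicalType) (T : set (X -> X))
    (K : set X) :=
  [/\ K !=set0, closed K & forall f, T f -> f @` K `<=` K].

Definition minimal_sets (X : topologicalType) (T : set (X -> X)) :
    set (set X) :=
  [set K | closed_invariant T K /\
    forall L, closed_invariant T L -> L `<=` K -> L = K].

(* Main.v *)
Require Import Defs.
From mathcomp Require Import all_boot all_order all_algebra.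
From mathcomp Require Import all_classical all_reals all_analysis.
From mathcomp Require Import generic_quotient lra.
Import Order.TTheory GRing.Theory Num.Theory.
Import numFieldNormedType.Exports.

Set Implicit Arguments.
Unset Strict Implicit.
Unset Printing Implicit Defensive.

Local Open Scope classical_set_scope.
Local Open Scope card_scope.
Local Open Scope ring_scope.

(** The argument is about the order of points on the line.  Replace [T] by the
monoid [G] of all increasing lifts to the line of its elements and of the
identity; the minimal sets of [T] then correspond to those of [G], and the
lifts of [T^-1] are the inverses of those of [T].

Let [K] and [L] be disjoint closed [G]-invariant sets.  An arc from [K] to [L]
is an interval [[b, a]] with [b] in [K], [a] in [L] and no point of either set
in between.  As [K] and [L] are disjoint and closed, there are finitely many
arcs modulo integer translations ([arcs_finite]).  If [I] is an arc and [F] is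
in [G], then [F] maps the endpoints of [I] into [K] and [L], so the image [F I]
contains an arc.  Distinct arcs have images that overlap in at most a point,
hence [F] acts injectively on the finite set of arcs modulo translation, and
therefore surjectively: every arc lies in the image of an arc
([covered_exists]).  So the union of the arcs from [K] to [L] is a closed set
invariant under [G^-1], and it contains a minimal set of [G^-1].

Apply this to a minimal set [K] of [G] and to the closure [L] of the union of
all the other ones.  Arcs that belong to different [K] meet only at endpoints,
and the endpoints are finite in number modulo translation; a common minimal set
of [G^-1] would then contain a finite orbit.  This gives an injection from the
minimal sets of [G] to those of [G^-1] ([minimal_sets_le]); exchanging the
roles, the Cantor-Bernstein theorem concludes.

It remains to see that [K] is disjoint from [L] ([minimal_isolated]).  If [x]
in [K] is a limit of points of other minimal sets, then arcs between [K] and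
these sets shrink to [x].  Fix one arc [I] from [K] to another minimal set.  An
element of [G] that maps [I] over itself has rotation number zero, so it maps
each of the arcs near [x] over itself ([covers_self]) and fixes [x].  It
follows that [F x] modulo translation depends only on the arc which [F I]
covers, so that the orbit of [x] is finite ([finite_orbit_of_fixed]), which is
excluded. *)

(** * Closed sets of reals, finite sets and the covering of the circle *)

Lemma closed_approx (R : realType) (A : set R) (x : R) : closed A ->
  (forall e, 0 < e -> exists2 y, A y & `|x - y| < e) -> A x.
Proof.
move=> clA near_x; apply: clA => U /nbhs_ballP[e /= e0 eU].
by have [y Ay xy] := near_x _ e0; exists y; split=> //; apply: eU.
Qed.

Lemma closure_approx (R : realType) (A : set R) x e :
  closure A x -> 0 < e -> exists2 y, A y & `|x - y| < e.
Proof. by move=> clx e0; have [y [Ay xy]] := clx _ (nbhsx_ballx x e e0); exists y. Qed.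

Lemma far_of_notin (R : realType) (A : set R) x : closed A -> ~ A x ->
  exists2 e, 0 < e & forall y, A y -> y <= x - e \/ x + e <= y.
Proof.
move=> clA NAx; apply: contrapT => noe; apply: NAx; apply: closed_approx => // e e0.
apply: contrapT => noy; apply: noe; exists e => // y Ay.
have [le1|gt1] := leP y (x - e); first by left.
have [le2|gt2] := leP (x + e) y; first by right.
by case: noy; exists y => //; rewrite ltr_norml; lra.
Qed.

Lemma pigeonhole (X : Type) (S : set X) (u : nat -> X) :
  finite_set S -> (forall i, S (u i)) -> exists i k, u i = u (i + k.+1)%N.
Proof.
move=> finS uS; apply: contrapT => noeq; apply: infinite_nat.
have {noeq}lt_neq i j : (i < j)%N -> u i <> u j.
  move=> ij eq_u; apply: noeq; exists i, (j - i.+1)%N.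
  by rewrite addnS -addSn subnKC.
have -> : [set: nat] = u @^-1` S by apply/seteqP; split => // i _; exact: uS.
apply: finite_preimage => // i j _ _ eq_u.
by case: (ltngtP i j) => // [/lt_neq|/lt_neq/nesym].
Qed.

Lemma circle_piP (R : realType) (x y : R) :
  circle_pi x = circle_pi y <-> exists n : int, x = y + n%:~R.
Proof.
have -> : circle_pi x = circle_pi y <-> congr_int x y.
  by split=> [/eqmodP|?]; [|apply/eqmodP].
rewrite /congr_int; split=> [/intrP[n xy]|[n ->]].
  by exists n; rewrite -xy addrC subrK.
by rewrite addrC addKr; apply/intrP; exists n.
Qed.

Lemma addr_intE (R : realType) (F : R -> R) (n : int) x :
  (forall y, F (y + 1) = F y + 1) -> F (x + n%:~R) = F x + n%:~R.
Proof.
move=> F1; have addn (m : nat) y : F (y + m%:R) = F y + m%:R.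
  elim: m => [|m IHm]; first by rewrite !addr0.
  by rewrite -natr1 !addrA F1 IHm.
case: n => m; first exact: addn.
by rewrite NegzE mulrNz -[in RHS](subrK m.+1%:R x) addn addrK.
Qed.

Lemma sub_floor_itv (R : realType) (x : R) :
  `[0, 1]%classic (x + (- Num.floor x)%:~R).
Proof.
rewrite /= in_itv /= mulrNz; have /andP[] := floor_itv x.
by rewrite intrD mulr1z => ? ?; apply/andP; split; lra.
Qed.

Lemma last_before (R : realType) (A : set R) (x y : R) :
  closed A -> A y -> y <= x ->
  exists b, [/\ A b, y <= b, b <= x & forall z, b < z -> z <= x -> ~ A z].
Proof.
move=> clA Ay yx; pose S := A `&` [set z | z <= x].
have clS : closed S by apply: closedI => //; exact: closed_le.
have Sy : S y by [].
have ubS : has_ubound S by exists x => z [].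
have [Ab bx] : S (sup S).
  by move/closure_id: clS => clS; rewrite [X in X _]clS; apply: closure_sup => //; exists y.
exists (sup S); split => //; first exact: ub_le_sup.
by move=> z bz zx Az; move: bz; rewrite ltNge ub_le_sup.
Qed.

Lemma first_after (R : realType) (A : set R) (x y : R) :
  closed A -> A y -> x <= y ->
  exists a, [/\ A a, x <= a, a <= y & forall z, x <= z -> z < a -> ~ A z].
Proof.
move=> clA Ay xy.
have clN : closed [set z | A (- z)].
  by apply: preimage_closed clA => z _; apply: opp_continuous.
have [||b [Ab yb bx nob]] := @last_before R _ (- x) (- y) clN.
- by rewrite /= opprK.
- by rewrite lerN2.
exists (- b); split=> //; [lra | lra |] => z xz zb.
by have := nob (- z); rewrite /= opprK; apply; lra.
Qed.

(** * Monoids of lifts and their arcs *)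

(** As integer translations belong to [G], a [G]-invariant set is periodic, so
that the closed [G]-invariant sets of the line are the inverse images of closed
sets of the circle, and minimality on the line means minimality on the circle.
Continuity of the elements of [G] follows from monotonicity and bijectivity. *)
Record lift_monoid (R : realType) (G : set (R -> R)) : Prop := LiftMonoid {
  lift_incr : forall F, G F -> {homo F : x y / x < y};
  lift_inv : forall F, G F -> exists F', inverse_of F F';
  lift_addr1 : forall F, G F -> forall x, F (x + 1) = F x + 1;
  lift_transl : forall n : int, G (fun x => x + n%:~R);
  lift_comp : forall F H, G F -> G H -> G (F \o H);
  lift_orbit : forall x, ~ finite_set [set circle_pi (F x) | F in G] }.

Definition transl (R : realType) (I : R * R) (n : int) : R * R :=
  (I.1 + n%:~R, I.2 + n%:~R).

Definition arc (R : realType) (K L : set R) (I : R * R) :=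
  [/\ K I.1, L I.2, I.1 < I.2 &
      forall x, I.1 < x -> x < I.2 -> ~ K x /\ ~ L x].

(** [covers F I J] means that [J] lies in [F I]; for increasing [F] the
comparison of endpoints suffices. *)
Definition covers (R : realType) (F : R -> R) (I J : R * R) :=
  F I.1 <= J.1 /\ J.2 <= F I.2.

Lemma lift_le (R : realType) (G : set (R -> R)) F :
  lift_monoid G -> G F -> {mono F : x y / x <= y}.
Proof. by move=> GG GF; apply: le_mono; exact: lift_incr GF. Qed.

Lemma lift_lt (R : realType) (G : set (R -> R)) F :
  lift_monoid G -> G F -> {mono F : x y / x < y}.
Proof. by move=> GG GF; apply: leW_mono; exact: lift_le GF. Qed.

Lemma lift_addr (R : realType) (G : set (R -> R)) F (n : int) x :
  lift_monoid G -> G F -> F (x + n%:~R) = F x + n%:~R.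
Proof. by move=> GG GF; exact: addr_intE (lift_addr1 GG GF). Qed.

Lemma lift_iter (R : realType) (G : set (R -> R)) F k :
  lift_monoid G -> G F -> G (iter k F).
Proof.
move=> GG GF; elim: k => [|k IHk].
  by have := lift_transl GG 0; congr G; apply/funext => x; rewrite addr0.
by have := lift_comp GG GF IHk.
Qed.

Lemma closed_invariant_addr (R : realType) (G : set (R -> R)) K (n : int) x :
  lift_monoid G -> closed_invariant G K -> K x -> K (x + n%:~R).
Proof.
by move=> GG [_ _ KG] Kx; apply: (KG _ (lift_transl GG n)); exists x.
Qed.

Lemma closed_invariant_gt (R : realType) (G : set (R -> R)) K x :
  lift_monoid G -> closed_invariant G K -> exists2 y, K y & x < y.
Proof.
move=> GG KG; have [y Ky] : K !=set0 by case: KG.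
exists (y + (Num.floor (x - y) + 1)%:~R); first exact: closed_invariant_addr KG _.
have /andP[_] := floor_itv (x - y); lra.
Qed.

(** The right endpoint is the first point of [L] after [k], and the left one is
the last point of [K] before it. *)
Lemma arc_between (R : realType) (K L : set R) k l :
  closed K -> closed L -> K `&` L = set0 -> K k -> L l -> k < l ->
  exists I, [/\ arc K L I, k <= I.1 & I.2 <= l].
Proof.
move=> clK clL KL0 Kk Ll kl.
have disj x : K x -> ~ L x by move=> Kx Lx; have : (K `&` L) x by []; rewrite KL0.
have [a [La ka al noL]] := first_after clL Ll (ltW kl).
have [b [Kb kb ba noK]] := last_before clK Kk ka.
exists (b, a); split=> //; split=> //=.
  by rewrite lt_neqAle ba andbT; apply/eqP => eq_ba; apply: (disj b) => //; rewrite eq_ba.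
move=> x bx xa; split; [apply: noK => //; exact: ltW|apply: noL => //; lra].
Qed.

Lemma arc_lt_or_eq (R : realType) (K L : set R) I J :
  arc K L I -> arc K L J -> I.2 <= J.1 \/ J.2 <= I.1 \/ I = J.
Proof.
case: I J => [b a] [b' a'] [/= Kb La ba noKL] [/= Kb' La' ba' noKL'].
case: (ltgtP b b') => [bb'|bb'|eqb].
- by left; rewrite leNgt; apply/negP => /(noKL _ bb')[].
- by right; left; rewrite leNgt; apply/negP => /(noKL' _ bb')[].
right; right; case: (ltgtP a a') => [aa'|aa'|->]; last by rewrite eqb.
  by have [|_] := noKL' a _ aa'; rewrite -?eqb.
by have [|_] := noKL a' _ aa'; rewrite ?eqb.
Qed.

Lemma arc_transl (R : realType) (G : set (R -> R)) K L I (n : int) :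
  lift_monoid G -> closed_invariant G K -> closed_invariant G L ->
  arc K L I -> arc K L (transl I n).
Proof.
move=> GG KG LG [Kb La ba noKL]; split => /=.
- exact: closed_invariant_addr KG Kb.
- exact: closed_invariant_addr LG La.
- lra.
move=> x bx xa.
have [||noK noL] := noKL (x + (- n)%:~R); first by rewrite mulrNz; lra.
  by rewrite mulrNz; lra.
by split=> Kx; [apply: noK|apply: noL]; apply: closed_invariant_addr Kx => //; eassumption.
Qed.

(** If infinitely many arcs started in a period, their left endpoints would
accumulate at a point of [K]; an arc between two of these endpoints ends in
[L], so the limit would lie in [L] as well. *)
Lemma arcs_finite (R : realType) (G : set (R -> R)) K L :
  lift_monoid G -> closed_invariant G K -> closed_invariant G L ->
  K `&` L = set0 ->
  finite_set [set circle_pi I.1 | I in arc K L].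
Proof.
move=> GG KG LG KL0; pose B := [set I.1 | I in arc K L] `&` `[0, 1]%classic.
suff finB : finite_set B.
  apply: sub_finite_set (finite_image (@circle_pi R) finB) => _ [I arcI <-].
  exists (I.1 + (- Num.floor I.1)%:~R); last first.
    by apply/circle_piP; exists (- Num.floor I.1).
  split; first by exists (transl I (- Num.floor I.1)) => //; exact: (arc_transl _ GG KG LG).
  exact: sub_floor_itv.
apply: contrapT => infB.
have [|x xlim] := infinite_bounded_limit_point_nonempty infB.
  exists 1; split; first exact: num_real.
  move=> M M1 x [_] /=; rewrite in_itv /= => /andP[x0 x1].
  by rewrite ger0_norm //; lra.
have [[_ clK _] [_ clL _]] := (KG, LG).
have Kx : K x.
  apply: clK; apply: closureS (subset_limit_point xlim).
  by move=> _ [[I [] ? _ _ _ <-]].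
have [e e0 noL] : exists2 e, 0 < e & forall y, `|x - y| < e -> ~ L y.
  apply: contrapT => noe; have : (K `&` L) x; last by rewrite KL0.
  split=> //; apply: closed_approx => // e e0; apply: contrapT => noy.
  by apply: noe; exists e => // y xy Ly; apply: noy; exists y.
move/limit_point_infinite_setP: xlim => /(_ _ (nbhsx_ballx x e e0)) inf2.
suff : ball x e `&` B `<=` [set (xget 0 (ball x e `&` B))].
  by move/sub_finite_set => fin1; exact/inf2/fin1/finite_set1.
move=> y yB; have [] := xgetPex 0 (ex_intro (ball x e `&` B) y yB); move: yB.
move: (xget _ _) => z [xy [[I arcI Iy] _]] xz [[J arcJ Jz] _].
rewrite /=; move: xy xz; rewrite /ball /= -{}Iy -{}Jz => xI xJ.
have [_ LI ltI _] := arcI; have [_ LJ ltJ _] := arcJ.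
have [IJ|[JI|->//]] := arc_lt_or_eq arcI arcJ.
  by case: (noL I.2) => //; move: xI xJ; rewrite !ltr_norml; lra.
by case: (noL J.2) => //; move: xI xJ; rewrite !ltr_norml; lra.
Qed.

(** * The action of a monoid of lifts on arcs *)

Lemma covers_exists (R : realType) (G : set (R -> R)) K L F I :
  lift_monoid G -> closed_invariant G K -> closed_invariant G L ->
  K `&` L = set0 -> G F -> arc K L I -> exists2 J, arc K L J & covers F I J.
Proof.
move=> GG [_ clK KG] [_ clL LG] KL0 GF [KI LI ltI _].
have [||//|J [arcJ IJ JI]] := arc_between clK clL KL0 (_ : K (F I.1)) (_ : L (F I.2)).
- by apply: (KG F GF); exists I.1.
- by apply: (LG F GF); exists I.2.
- exact: lift_incr GF _ _ ltI.
by exists J.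
Qed.

Lemma covers_transl (R : realType) (G : set (R -> R)) F I J (n : int) :
  lift_monoid G -> G F -> covers F I J -> covers F (transl I n) (transl J n).
Proof.
by move=> GG GF [IJ JI]; split; rewrite /= (lift_addr _ _ GG GF) lerD2r.
Qed.

(** Images of distinct arcs are disjoint up to endpoints, so they cannot cover
the same arc. *)
Lemma covers_inj (R : realType) (G : set (R -> R)) K L F I I' J :
  lift_monoid G -> G F -> arc K L I -> arc K L I' -> arc K L J ->
  covers F I J -> covers F I' J -> I = I'.
Proof.
move=> GG GF arcI arcI' [_ _ ltJ _] [IJ JI] [I'J JI'].
have [|[|->//]] := arc_lt_or_eq arcI arcI'; rewrite -(lift_le GG GF) => ?; suff : (0 : R) < 0 by [rewrite ltxx]; lra.
Qed.

Lemma covers_homo (R : realType) (G : set (R -> R)) K L F I I' J J' :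
  lift_monoid G -> G F -> arc K L I -> arc K L I' -> arc K L J -> arc K L J' ->
  covers F I J -> covers F I' J' -> I.1 < I'.1 -> J.1 < J'.1.
Proof.
move=> GG GF arcI arcI' [_ _ ltJ _] [_ _ ltJ' _] [IJ JI] [I'J' J'I'].
have [_ _ ltI' _] := arcI'.
have [|[|->]] := arc_lt_or_eq arcI arcI'; last by rewrite ltxx.
  by rewrite -(lift_le GG GF); lra.
by lra.
Qed.

(** The pigeonhole principle finds two arcs of a chain that agree modulo
translation, and [covers_inj] moves this coincidence back to the first arc of
the chain. *)
Lemma arc_cycle (R : realType) (G : set (R -> R)) K L F I :
  lift_monoid G -> closed_invariant G K -> closed_invariant G L ->
  K `&` L = set0 -> G F -> arc K L I ->
  exists (u : nat -> R * R) (k : nat) (n : int),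
    [/\ u 0%N = I, forall i, arc K L (u i), forall i, covers F (u i) (u i.+1)
      & u k.+1 = transl I n].
Proof.
move=> GG KG LG KL0 GF arcI.
have /choice[phi phiP] : forall J, exists J', arc K L J -> arc K L J' /\ covers F J J'.
  move=> J; have [/(covers_exists GG KG LG KL0 GF)[J' ? ?]|noarc] := pselect (arc K L J).
    by exists J'.
  by exists J => /noarc.
pose u i := iter i phi I.
have arcu i : arc K L (u i) by elim: i => //= i /phiP[].
have covu i : covers F (u i) (u i.+1) by have [] := phiP _ (arcu i).
have [i [k]] := pigeonhole (arcs_finite GG KG LG KL0) (fun i => imageP _ (arcu i)).
move=> /esym/circle_piP[n eq_u]; exists u, k, n; split => //.
have {eq_u} : u (i + k.+1)%N = transl (u i) n.
  have arcT := arc_transl n GG KG LG (arcu i).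
  have [_ _ lt1 _] := arcu (i + k.+1)%N; have [_ _ /= lt2 _] := arcT.
  by have [/=|[/=|//]] := arc_lt_or_eq (arcu (i + k.+1)%N) arcT => ?; suff : (0 : R) < 0 by [rewrite ltxx]; lra.
elim: i => [//|i IHi]; rewrite addSn => eq_u; apply: IHi.
apply: (covers_inj GG GF (arcu _) (arc_transl n GG KG LG (arcu _)) (arcu (i + k.+1).+1) (covu _)).
by rewrite eq_u; exact: covers_transl GG GF (covu i).
Qed.

Lemma covered_exists (R : realType) (G : set (R -> R)) K L F J :
  lift_monoid G -> closed_invariant G K -> closed_invariant G L ->
  K `&` L = set0 -> G F -> arc K L J -> exists2 I, arc K L I & covers F I J.
Proof.
move=> GG KG LG KL0 GF arcJ.
have [u [k [n [u0 arcu covu uk]]]] := arc_cycle GG KG LG KL0 GF arcJ.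
exists (transl (u k) (- n)); first exact: (arc_transl _ GG KG LG).
have := covers_transl (- n) GG GF (covu k); rewrite uk.
suff -> : transl (transl J n) (- n) = J by [].
by case: J {arcJ u0 uk} => b a; rewrite /transl /= mulrNz !addrK.
Qed.

Lemma covers_iter (R : realType) (G : set (R -> R)) F (u : nat -> R * R) k :
  lift_monoid G -> G F -> (forall i, covers F (u i) (u i.+1)) ->
  covers (iter k F) (u 0%N) (u k).
Proof.
move=> GG GF covu; elim: k => [|k [IH1 IH2]]; first by [].
have [cov1 cov2] := covu k; split => /=.
  by apply: le_trans cov1; rewrite (lift_le GG GF).
by apply: (le_trans cov2); rewrite (lift_le GG GF).
Qed.

Lemma iter_le_fix (R : realType) (G : set (R -> R)) F p k :
  lift_monoid G -> G F -> F p <= p -> iter k F p <= p.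
Proof.
move=> GG GF Fp; elim: k => //= k IHk.
by apply: le_trans Fp; rewrite (lift_le GG GF).
Qed.

Lemma iter_ge_fix (R : realType) (G : set (R -> R)) F p k :
  lift_monoid G -> G F -> p <= F p -> p <= iter k F p.
Proof.
move=> GG GF Fp; elim: k => //= k IHk.
by apply: (le_trans Fp); rewrite (lift_le GG GF).
Qed.

(** The points [p] and [q] force the rotation number of [F] to be zero.  The
chain of [arc_cycle] that starts at [I] is monotone since [F] preserves the
order of arcs; as it returns to [I] up to a translation by [n], and as [n] is
zero because iterates of [F] displace no point by a whole period, it is
constant. *)
Lemma covers_self (R : realType) (G : set (R -> R)) K L F I p q :
  lift_monoid G -> closed_invariant G K -> closed_invariant G L ->
  K `&` L = set0 -> G F -> arc K L I -> F p <= p -> q <= F q -> covers F I I.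
Proof.
move=> GG KG LG KL0 GF arcI Fp Fq.
have [u [k [n [u0 arcu covu uk]]]] := arc_cycle GG KG LG KL0 GF arcI.
have [] := covers_iter k.+1 GG GF covu; rewrite u0 uk /= -!iterS => cov1 cov2.
have GFk := lift_iter k.+1 GG GF.
have n_le0 : (n <= 0)%R.
  rewrite leNgt; apply/negP => n_gt0.
  have n1 : 1 <= n%:~R :> R by rewrite -[1]/(1%:~R) ler_int.
  have /andP[fl1 fl2] := floor_itv (I.2 - p).
  have ltI : I.2 < p + (Num.floor (I.2 - p) + 1)%:~R by lra.
  have := iter_le_fix k.+1 GG GF Fp.
  have := lift_incr GG GFk ltI; rewrite (lift_addr _ _ GG GFk).
  by move: fl1 fl2; rewrite intrD mulr1z; lra.
have n_ge0 : (0 <= n)%R.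
  rewrite leNgt; apply/negP => n_lt0.
  have n1 : n%:~R <= - 1 :> R by rewrite -[- 1]/((- 1)%:~R) ler_int -(ltzD1 n) addrC subrr.
  have /andP[fl1 fl2] := floor_itv (I.1 - q).
  have : iter k.+1 F (q + (Num.floor (I.1 - q))%:~R) <= iter k.+1 F I.1.
    by rewrite (lift_le GG GFk); lra.
  rewrite (lift_addr _ _ GG GFk); have := iter_ge_fix k.+1 GG GF Fq.
  by move: fl1 fl2; rewrite intrD mulr1z; lra.
have {n_le0 n_ge0} n0 : n = 0 by apply/eqP; rewrite eq_le n_le0 n_ge0.
have {}uk : (u k.+1).1 = (u 0%N).1 by rewrite uk u0 n0 /= addr0.
have [lt01|[lt10|eq01]] : (u 0%N).1 < (u 1%N).1 \/ (u 1%N).1 < (u 0%N).1 \/ u 0%N = u 1%N.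
- have [_ _ lt0 _] := arcu 0%N; have [_ _ lt1 _] := arcu 1%N.
  by have [|[|]] := arc_lt_or_eq (arcu 0%N) (arcu 1%N); [left|right; left|right; right] => //; lra.
- have ltu i : (u i).1 < (u i.+1).1.
    by elim: i => // i IHi; exact: (covers_homo GG GF (arcu i) (arcu i.+1)).
  have : (u 0%N).1 < (u k.+1).1 by elim: {uk cov1 cov2 GFk} k => // k IHk; exact: lt_trans IHk (ltu _).
  by rewrite uk ltxx.
- have ltu i : (u i.+1).1 < (u i).1.
    by elim: i => // i IHi; exact: (covers_homo GG GF (arcu i.+1) (arcu i)).
  have : (u k.+1).1 < (u 0%N).1 by elim: {uk cov1 cov2 GFk} k => // k IHk; exact: lt_trans (ltu _) IHk.
  by rewrite uk ltxx.
by have := covu 0%N; rewrite -eq01 u0.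
Qed.

(** * Finite orbits produced by shrinking arcs *)

(** If [H x] differed from [x], then an arc close enough to [x] would lie
between [x] and the image or the preimage of [x], and [H] would move
it off itself. *)
Lemma fixed_of_covered_limit (R : realType) (G : set (R -> R)) H x :
  lift_monoid G -> G H ->
  (forall e, 0 < e -> exists I : R * R, [/\ covers H I I, x - e < I.1, I.1 < I.2,
     I.2 < x + e & x <= I.1 \/ I.2 <= x]) ->
  H x = x.
Proof.
move=> GG GH lim; have [H' [_ HK]] := lift_inv GG GH.
have [lt_mono le_mono] := (lift_lt GG GH, lift_le GG GH).
case: (ltgtP (H x) x) => // Hx.
- have zx : x < H' x by rewrite -lt_mono HK.
  have [|I [[I1 I2] xI II Ix []]] := lim (Num.min (x - H x) (H' x - x)).
  + by rewrite lt_min !subr_gt0 Hx zx.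
  + move=> xI1; have : I.2 < H' x by move: Ix; rewrite -ltrBlDl lt_min; lra.
    by rewrite -lt_mono HK; lra.
  + move=> I2x; have : H x < I.1 by move: xI; rewrite ltrBlDl -ltrBlDr lt_min; lra.
    by move: I2x; rewrite -le_mono; lra.
- have zx : H' x < x by rewrite -lt_mono HK.
  have [|I [[I1 I2] xI II Ix []]] := lim (Num.min (H x - x) (x - H' x)).
  + by rewrite lt_min !subr_gt0 Hx zx.
  + move=> xI1; have : I.2 < H x by move: Ix; rewrite -ltrBlDl lt_min; lra.
    by move: xI1; rewrite -le_mono; lra.
  + move=> I2x; have : H' x < I.1 by move: xI; rewrite ltrBlDl -ltrBlDr lt_min; lra.
    by rewrite -lt_mono HK; lra.
Qed.

Lemma covers_comp (R : realType) (G : set (R -> R)) F H I J J' :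
  lift_monoid G -> G H -> covers F I J -> covers H J J' -> covers (H \o F) I J'.
Proof.
move=> GG GH [IJ JI] [JJ' J'J]; split => /=.
  by apply: le_trans JJ'; rewrite (lift_le GG GH).
by apply: (le_trans J'J); rewrite (lift_le GG GH).
Qed.

(** [F] permutes the finitely many arcs modulo translation, so that an iterate
of [F] goes from [J] back to the only arc sent over [J], which is [I]. *)
Lemma covers_return (R : realType) (G : set (R -> R)) K L F I J :
  lift_monoid G -> closed_invariant G K -> closed_invariant G L ->
  K `&` L = set0 -> G F -> arc K L I -> arc K L J -> covers F I J ->
  exists2 H, G H & covers H J I.
Proof.
move=> GG KG LG KL0 GF arcI arcJ covIJ.
have [u [k [m [u0 arcu covu uk]]]] := arc_cycle GG KG LG KL0 GF arcJ.
have uk' : u k = transl I m.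
  apply: (covers_inj GG GF (arcu k) (arc_transl m GG KG LG arcI) (arcu k.+1) (covu k)).
  by rewrite uk; exact: covers_transl GG GF covIJ.
exists ((fun x => x + (- m)%:~R) \o iter k F).
  exact (lift_comp GG (lift_transl GG _) (lift_iter k GG GF)).
have [] := covers_iter k GG GF covu; rewrite u0 uk' /= => cov1 cov2.
by split; rewrite /= mulrNz; [move: cov1|move: cov2]; lra.
Qed.

(** If [F I] and [F' I] cover the same arc [J], take [H] with [H J] covering
[I].  Both [H \o F] and [H \o F'] send [I] over itself, so they fix [x], and
[F x = F' x] as [H] is injective.  Hence there are at most as many values of
[F x] modulo translation as there are arcs. *)
Lemma finite_orbit_of_fixed (R : realType) (G : set (R -> R)) K L I x :
  lift_monoid G -> closed_invariant G K -> closed_invariant G L ->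
  K `&` L = set0 -> arc K L I ->
  (forall H, G H -> covers H I I -> H x = x) ->
  finite_set [set circle_pi (F x) | F in G].
Proof.
move=> GG KG LG KL0 arcI fixx.
(* [S b] collects the points [F x] for which [F I] covers an arc that starts
   at [b]; it has at most one element. *)
pose S b := [set y | exists F J,
  [/\ G F, arc K L J, covers F I J, circle_pi J.1 = b & y = circle_pi (F x)]].
apply: (@sub_finite_set _ _ (\bigcup_(b in [set circle_pi J.1 | J in arc K L]) S b)).
  move=> _ [F GF <-]; have [J arcJ covJ] := covers_exists GG KG LG KL0 GF arcI.
  by exists (circle_pi J.1); [exists J | exists F, J].
apply: bigcup_finite; first exact: arcs_finite GG KG LG KL0.
move=> b _; have [[y0 y0S]|S0] := pselect (S b !=set0); last first.
  by have -> : S b = set0 by apply: contrapT => /eqP/set0P.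
apply: (@sub_finite_set _ _ [set y0]) => // y.
case: y0S => F' [J' [GF' arcJ' covJ' Jb' ->]] [F [J [GF arcJ covJ Jb ->]]].
have /circle_piP[n eqJ] : circle_pi J.1 = circle_pi J'.1 by rewrite Jb Jb'.
have arcT := arc_transl n GG KG LG arcJ'.
have {eqJ}eqJ : J = transl J' n.
  have [_ _ lt1 _] := arcJ; have [_ _ /= lt2 _] := arcT.
  by have [/=|[/=|//]] := arc_lt_or_eq arcJ arcT => ?;
    suff : (0 : R) < 0 by [rewrite ltxx]; lra.
apply/circle_piP; exists n.
have [H GH covH] := covers_return GG KG LG KL0 GF arcI arcJ covJ.
have GT := lift_comp GG (lift_transl GG n) GF'.
have covT : covers ((fun x => x + n%:~R) \o F') I J.
  by case: covJ'; rewrite eqJ; split => /=; lra.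
have [H' [HK _]] := lift_inv GG GH.
apply: (can_inj HK); rewrite -[LHS]/((H \o F) x).
rewrite -[RHS]/((H \o ((fun x => x + n%:~R) \o F')) x).
rewrite !fixx //.
- exact (lift_comp GG GH GT).
- exact: covers_comp GG GH covT covH.
- exact (lift_comp GG GH GF).
- exact: covers_comp GG GH covJ covH.
Qed.

(** * The inverse of a monoid of lifts *)

Lemma inverse_iter (X : Type) (f g : X -> X) k :
  inverse_of f g -> inverse_of (iter k f) (iter k g).
Proof.
move=> [fK gK]; elim: k => [|k [IH1 IH2]]; first by [].
by split=> x; rewrite iterS iterSr ?fK ?gK ?IH1 ?IH2.
Qed.

Lemma inverse_setK (X : Type) (G : set (X -> X)) :
  (forall F, G F -> exists F', inverse_of F F') ->
  inverse_set (inverse_set G) = G.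
Proof.
move=> invG; apply/seteqP; split=> [F [F' [F0 GF0 [_ F'K]] [_ FK']]|F GF].
  suff -> : F = F0 by [].
  by apply/funext => x; rewrite -[in RHS](FK' x) F'K.
have [F' [FK F'K]] := invG F GF.
by exists F' => //; exists F.
Qed.

(** If the orbit of [x] under the inverses were finite modulo translation, then
each inverse [F'] would have [x] as a periodic point modulo translation, so
[F x] would be a translate of a point of that same orbit. *)
Lemma lift_monoid_inverse (R : realType) (G : set (R -> R)) :
  lift_monoid G -> lift_monoid (inverse_set G).
Proof.
move=> GG; split.
- by move=> F' [F GF [FK F'K]] x y; rewrite -{1}(F'K x) -{1}(F'K y) (lift_lt GG GF).
- by move=> F' [F GF [FK F'K]]; exists F.
- move=> F' [F GF [FK F'K]] x.
  by rewrite -{1}(F'K x) -(lift_addr1 GG GF) FK.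
- move=> n; exists (fun x => x + (- n)%:~R); first exact: lift_transl.
  by split=> x; rewrite mulrNz ?addrK ?subrK.
- move=> F' H' [F GF [FK F'K]] [H GH [HK H'K]].
  exists (H \o F); first exact: lift_comp.
  by split=> x /=; rewrite ?HK ?FK ?F'K ?H'K.
move=> x finS; apply: (lift_orbit GG (x := x)); apply: (sub_finite_set _ finS).
move=> _ [F GF <-]; have [F' FF'] := lift_inv GG GF.
have GF' k : inverse_set G (iter k F').
  by exists (iter k F); [exact: lift_iter | exact: inverse_iter].
have [i [k]] := @pigeonhole _ _ (fun i => circle_pi (iter i F' x)) finS
  (fun i => imageP (fun F => circle_pi (F x)) (GF' i)).
move=> /circle_piP[n /(congr1 (iter i F))]; rewrite iterD.
rewrite (lift_addr _ _ GG (lift_iter i GG GF)).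
have [_ iterK] := inverse_iter i FF'; rewrite !iterK => /(congr1 F).
rewrite (lift_addr _ _ GG GF) /= (proj2 FF') => Fx.
by exists (iter k F'); [exact: GF' | apply/esym/circle_piP; exists n].
Qed.

(** * Minimal sets of a monoid of lifts *)

Lemma closed_invariant_closure (R : realType) (G : set (R -> R)) (U : set R) :
  lift_monoid G -> U !=set0 -> (forall F, G F -> F @` U `<=` U) ->
  closed_invariant G (closure U).
Proof.
move=> GG [u Uu] UG; split; [by exists u; exact: subset_closure | exact: closed_closure |].
move=> F GF _ [x clx <-]; have [F' [_ FK]] := lift_inv GG GF.
apply: closed_approx; first exact: closed_closure.
move=> e e0; have lt_mono := lift_lt GG GF.
have x1 : F' (F x - e) < x by rewrite -lt_mono FK; lra.
have x2 : x < F' (F x + e) by rewrite -lt_mono FK; lra.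
have [|y Uy] := @closure_approx _ _ _ (Num.min (x - F' (F x - e)) (F' (F x + e) - x)) clx.
  by rewrite lt_min !subr_gt0 x1.
rewrite lt_min !ltr_norml => /andP[/andP[_ xy1] /andP[xy2 _]].
exists (F y); first by apply: subset_closure; apply: (UG _ GF); exists y.
have y1 : F (F' (F x - e)) < F y by rewrite lt_mono; lra.
have y2 : F y < F (F' (F x + e)) by rewrite lt_mono; lra.
by move: y1 y2; rewrite !FK ltr_norml; lra.
Qed.

Lemma minimal_subset (X : topologicalType) (T : set (X -> X)) K L :
  minimal_sets T K -> closed_invariant T L -> K `&` L !=set0 -> K `<=` L.
Proof.
move=> [[_ clK KT] minK] [_ clL LT] KL.
suff <- : K `&` L = K by move=> x [].
apply: minK; last by move=> x [].
split=> //; first exact: closedI.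
move=> f Tf _ [x [Kx Lx] <-].
by split; [apply: (KT f Tf) | apply: (LT f Tf)]; exists x.
Qed.

Lemma minimal_disjoint (X : topologicalType) (T : set (X -> X)) K L :
  minimal_sets T K -> minimal_sets T L -> K <> L -> K `&` L = set0.
Proof.
move=> minK minL neqKL; apply: contrapT => /eqP/set0P KL; apply: neqKL.
apply/seteqP; split; first exact: minimal_subset minK minL.1 KL.
by apply: minimal_subset minL minK.1 _; rewrite setIC.
Qed.

Definition other_minimal (X : topologicalType) (T : set (X -> X)) (K : set X) :=
  \bigcup_(L in minimal_sets T `\ K) L.

Lemma other_minimal_invariant (X : topologicalType) (T : set (X -> X)) K f :
  T f -> f @` other_minimal T K `<=` other_minimal T K.
Proof.
move=> Tf _ [x [L minL Lx] <-]; have [[[_ _ LT] _] _] := minL.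
by exists L => //; apply: (LT f Tf); exists x.
Qed.

(** Near a point [x] of both sets lie arcs between [K] and other minimal sets,
directed either way according to the side from which [x] is approached; the
fixed arc [I] from [K] to some other minimal set [L] serves to count the orbit
of [x]. *)
Lemma minimal_isolated (R : realType) (G : set (R -> R)) (K : set R) :
  lift_monoid G -> minimal_sets G K -> K `&` closure (other_minimal G K) = set0.
Proof.
move=> GG minK; apply: contrapT => /eqP/set0P[x [Kx clx]].
have KG := minK.1; have [_ clK _] := KG.
have [y [L [minL neqLK] _] _] := closure_approx clx ltr01.
have disj L' : minimal_sets G L' -> L' <> K -> L' `&` K = set0 /\ K `&` L' = set0.
  move=> minL' neqL'; have L'K0 := minimal_disjoint minL' minK neqL'.
  by split; [|rewrite setIC].
have [_ KL0] := disj _ minL neqLK; have LG := minL.1; have [_ clL _] := LG.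
have [l Ll xl] := closed_invariant_gt x GG LG.
have [I [arcI _ _]] := arc_between clK clL KL0 Kx Ll xl.
apply: (lift_orbit GG (x := x)).
apply: (finite_orbit_of_fixed GG KG LG KL0 arcI) => H GH [HI1 HI2].
apply: (fixed_of_covered_limit GG GH) => e e0.
have [z [L' [minL' neqL'K] L'z] xz] := closure_approx clx e0.
have [L'K0 KL'0] := disj _ minL' neqL'K; have L'G := minL'.1; have [_ clL' _] := L'G.
move: xz; rewrite ltr_norml => /andP[xz1 xz2].
case: (ltgtP x z) => [xz|zx|eqxz].
- have [J [arcJ xJ Jz]] := arc_between clK clL' KL'0 Kx L'z xz.
  have [_ _ ltJ _] := arcJ.
  exists J; split; [exact: (covers_self GG KG L'G KL'0 GH arcJ HI1 HI2)| | | |left]; lra.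
- have [J [arcJ zJ Jx]] := arc_between clL' clK L'K0 L'z Kx zx.
  have [_ _ ltJ _] := arcJ.
  exists J; split; [exact: (covers_self GG L'G KG L'K0 GH arcJ HI1 HI2)| | | |right]; lra.
have : (K `&` L') x by split=> //; rewrite eqxz.
by rewrite KL'0.
Qed.

(** Zorn's lemma is applied to the complements.  The intersection of a chain of
closed invariant sets is nonempty since each of them, being periodic, meets
the compact interval [[0, 1]]. *)
Lemma minimal_exists (R : realType) (G : set (R -> R)) (K : set R) :
  lift_monoid G -> closed_invariant G K ->
  exists2 M, minimal_sets G M & M `<=` K.
Proof.
move=> GG KG; have [K0 clK invK] := KG.
have [F FP totF|A [PA maxA]] := @Zorn_bigcup _ [set A | closed_invariant G (K `\` A)]; last first.
  exists (K `\` A); last by move=> x [].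
  split=> // L LG LKA; apply/seteqP; split=> // x [Kx NAx].
  apply: contrapT => NLx; have := maxA (~` L); apply.
    split; first by move=> z Az Lz; have [_] := LKA z Lz.
    by move=> /(_ x NLx).
  rewrite /=; suff -> : K `\` ~` L = L by [].
  by rewrite setDE setCK; apply/setIidPr => z /LKA[].
have [[A0 FA0]|F0] := pselect (F !=set0); last first.
  suff -> : \bigcup_(X in F) X = set0 by rewrite /= setD0.
  by rewrite bigcup0 // => A FA; case: F0; exists A.
(* A cluster point of the filter generated by the traces on [[0, 1]] lies in
   all members of the chain. *)
pose B A := (K `\` A) `&` `[0, 1]%classic.
have filB : ProperFilter (filter_from F B).
  apply: filter_from_proper.
    apply: filter_from_filter; first by exists A0.
    move=> A1 A2 FA1 FA2; have [A12|A21] := totF _ _ FA1 FA2.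
      by exists A2 => // x [[Kx NA] x01]; split; split=> //; split=> // /A12.
    by exists A1 => // x [[Kx NA] x01]; split; split=> //; split=> // /A21.
  move=> A FA; have AG := FP _ FA; have [[x KAx] _ _] := AG.
  exists (x + (- Num.floor x)%:~R); split; first exact: closed_invariant_addr GG AG KAx.
  exact: sub_floor_itv.
have [|x [_ clx]] := @segment_compact R 0 1 _ filB.
  by exists A0 => // x [].
have KAx A : F A -> (K `\` A) x.
  move=> FA; have [_ clA _] := FP _ FA; apply: clA.
  move=> V Vx; have [||y [[KAy _] Vy]] := clx (B A) V => //; first by exists A.
  by exists y.
split.
- by exists x; split; [have [] := KAx _ FA0 | move=> [A FA Ax]; have [_] := KAx _ FA].
- rewrite (_ : K `\` _ = \bigcap_(A in F) (K `\` A)); last first.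
    apply/seteqP; split=> [z [Kz Nz] A FA|z Kz].
      by split=> // Az; apply: Nz; exists A.
    by split; [have [] := Kz _ FA0 | move=> [A FA Az]; have [_] := Kz _ FA].
  by apply: closed_bigI => A FA; have [] := FP _ FA.
move=> f Gf _ [z [Kz Nz] <-]; split; first by apply: (invK f Gf); exists z.
move=> [A FA Afz]; have [_ _ invA] := FP _ FA.
have [] : (K `\` A) (f z) by apply: (invA f Gf); exists z => //; split=> // Az; apply: Nz; exists A.
by [].
Qed.

(** * Counting the minimal sets of the inverse monoid *)

Definition arcs_union (R : realType) (K L : set R) :=
  [set x | exists I, [/\ arc K L I, I.1 <= x & x <= I.2]].

(** Suppose that [x] is not in [K], the other case being symmetric.  Near [x]
there are no left endpoints, so an arc that meets a small neighbourhood of [x]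
and misses [x] ends before [x]; a second arc, met still closer to [x], would
then have to start after the end of the first one, in that neighbourhood. *)
Lemma closed_arcs_union (R : realType) (K L : set R) :
  closed K -> closed L -> K `&` L = set0 -> closed (arcs_union K L).
Proof.
move=> clK clL KL0 x clx.
have [Kx|/(far_of_notin clK)[e e0 farK]] := pselect (K x).
  have /(far_of_notin clL)[e e0 farL] : ~ L x.
    by move=> Lx; have : (K `&` L) x by []; rewrite KL0.
  have [y [I [arcI Iy yI]]] := closure_approx clx e0.
  rewrite ltr_norml => /andP[xy1 xy2]; have [KI LI ltI _] := arcI.
  have Ie : x + e <= I.2 by have [] := farL _ LI; lra.
  have [Ix|xI] := leP I.1 x; first by exists I; split=> //; lra.
  have d0 : 0 < I.1 - x by rewrite subr_gt0.
  have [z [J [arcJ Jz zJ]]] := closure_approx clx d0.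
  rewrite ltr_norml => /andP[xz1 xz2]; have [KJ LJ ltJ _] := arcJ.
  have Je : x + e <= J.2 by have [] := farL _ LJ; lra.
  exists J; split=> //; last by lra.
  rewrite leNgt; apply/negP => xJ.
  have [|[|eqIJ]] := arc_lt_or_eq arcI arcJ; first by lra.
    by lra.
  by move: Jz; rewrite -eqIJ; lra.
have [y [I [arcI Iy yI]]] := closure_approx clx e0.
rewrite ltr_norml => /andP[xy1 xy2]; have [KI LI ltI _] := arcI.
have Ie : I.1 <= x - e by have [] := farK _ KI; lra.
have [xI|Ix] := leP x I.2; first by exists I; split=> //; lra.
have d0 : 0 < x - I.2 by rewrite subr_gt0.
  have [z [J [arcJ Jz zJ]]] := closure_approx clx d0.
rewrite ltr_norml => /andP[xz1 xz2]; have [KJ LJ ltJ _] := arcJ.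
have Je : J.1 <= x - e by have [] := farK _ KJ; lra.
exists J; split=> //; first by lra.
rewrite leNgt; apply/negP => xJ.
have [|[|eqIJ]] := arc_lt_or_eq arcI arcJ; first by lra.
  by lra.
by move: zJ; rewrite -eqIJ; lra.
Qed.

Lemma arcs_union_invariant (R : realType) (G : set (R -> R)) (K L : set R) :
  lift_monoid G -> closed_invariant G K -> closed_invariant G L ->
  K `&` L = set0 -> closed_invariant (inverse_set G) (arcs_union K L).
Proof.
move=> GG KG LG KL0; have [[k Kk] clK _] := KG; have [_ clL _] := LG.
split; last 2 first.
- exact: closed_arcs_union.
- move=> F' [F GF [FK F'K]] _ [x [J [arcJ Jx xJ]] <-].
  have [I arcI [IJ JI]] := covered_exists GG KG LG KL0 GF arcJ.
  by exists I; split=> //; rewrite -(lift_le GG GF) F'K; lra.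
have [l Ll kl] := closed_invariant_gt k GG LG.
have [I [arcI _ _]] := arc_between clK clL KL0 Kk Ll kl.
by exists I.1, I; split=> //; have [_ _ /ltW] := arcI.
Qed.

(** The injection sends [K] to a minimal set of the inverse monoid inside the
arcs that go from [K] to the other minimal sets.  When [K] is the only
minimal set there are no arcs, and any minimal set of the inverse monoid can be
its image. *)
Lemma minimal_sets_le (R : realType) (G : set (R -> R)) :
  lift_monoid G -> minimal_sets G #<= minimal_sets (inverse_set G).
Proof.
move=> GG; have GG' := lift_monoid_inverse GG.
pose L K := closure (other_minimal G K).
have LG K : other_minimal G K !=set0 -> closed_invariant G (L K).
  by move=> U0; apply: closed_invariant_closure => // F; exact: other_minimal_invariant.
have sub_L K K' : minimal_sets G K' -> K' <> K -> K' `<=` L K.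
  by move=> ? ? x K'x; apply: subset_closure; exists K'.
have other0 K K' : minimal_sets G K' -> K' <> K -> other_minimal G K !=set0.
  by move=> minK' neqK; have [[[x K'x] _ _] _] := minK'; exists x, K'.
have /choice[M MP] : forall K, exists M, minimal_sets G K ->
    minimal_sets (inverse_set G) M /\
    (other_minimal G K !=set0 -> M `<=` arcs_union K (L K)).
  move=> K; have [minK|?] := pselect (minimal_sets G K); last by exists set0.
  have KL0 := minimal_isolated GG minK.
  have [U0|U0] := pselect (other_minimal G K !=set0).
    have [M ? ?] := minimal_exists GG' (arcs_union_invariant GG minK.1 (LG _ U0) KL0).
    by exists M.
  have TG : closed_invariant (inverse_set G) setT.
    by split=> //; exists 0.
  by have [M ? _] := minimal_exists GG' TG; exists M.
have injM : {in minimal_sets G &, injective M}.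
  move=> K K' /set_mem minK /set_mem minK' eqM; apply: contrapT => neqK.
  have [U0 U0'] : other_minimal G K !=set0 /\ other_minimal G K' !=set0.
    by split; [exact: other0 minK' (nesym neqK) | exact: other0 minK neqK].
  have [minM /(_ U0) sub1] := MP _ minK; have [_ /(_ U0') sub2] := MP _ minK'.
  have [KL0 KL0'] := (minimal_isolated GG minK, minimal_isolated GG minK').
  have [[[x Mx] _ MG] _] := minM.
  apply: (lift_orbit GG' (x := x)).
  have fin1 := arcs_finite GG minK.1 (LG _ U0) KL0.
  have fin2 := arcs_finite GG minK'.1 (LG _ U0') KL0'.
  apply: (sub_finite_set (B := [set circle_pi I.1 | I in arc K (L K)] `|`
     [set circle_pi I.1 | I in arc K' (L K')])); last by rewrite finite_setU.
  move=> _ [F GF <-]; have {}Mx : M K (F x) by apply: (MG F GF); exists x.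
  move: (F x) Mx => {F GF}y My; have := My; rewrite eqM => /sub2[J [arcJ Jy yJ]].
  have [I [arcI Iy yI]] := sub1 _ My.
  have [KI LI ltI noI] := arcI; have [KJ LJ ltJ noJ] := arcJ.
  (* Arcs of different sets overlap at most at the left endpoint of the later
     one, as this endpoint may not lie inside the earlier arc. *)
  have [lt12|lt21|eq12] := ltgtP I.1 J.1.
  - right; exists J => //; congr circle_pi; apply/eqP; rewrite eq_le Jy /=.
    apply: le_trans yI _; rewrite leNgt; apply/negP => /(noI _ lt12)[_]; apply.
    exact: (sub_L K K' minK' (nesym neqK)).
  - left; exists I => //; congr circle_pi; apply/eqP; rewrite eq_le Iy /=.
    apply: le_trans yJ _; rewrite leNgt; apply/negP => /(noJ _ lt21)[_]; apply.
    exact: (sub_L K' K minK neqK).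
  have : (K `&` K') I.1 by split=> //; rewrite eq12.
  by rewrite (minimal_disjoint minK minK').
have cardM : minimal_sets G #= M @` minimal_sets G.
  by rewrite card_eq_sym; exact: inj_card_eq.
rewrite (card_le_eql cardM); apply: subset_card_le => _ [K minK <-].
by have [] := MP _ minK.
Qed.

(** * From the circle to the line *)

Lemma circle_pi_surj (R : realType) (p : circle R) : exists x, circle_pi x = p.
Proof. by exists (repr p); exact: reprK. Qed.

Definition lift_of (R : realType) (f : circle R -> circle R) (F : R -> R) :=
  [/\ {homo F : x y / x < y}, exists F', inverse_of F F',
      forall x, F (x + 1) = F x + 1 &
      forall x, f (circle_pi x) = circle_pi (F x)].

(** The identity is added so that the integer translations are lifts; this
changes neither the invariant sets nor the finiteness of orbits. *)
Definition lifts (R : realType) (T : set (circle R -> circle R)) : set (R -> R) :=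
  [set F | exists2 f, T f \/ f = id & lift_of f F].

(** [F (x + 1) - F x] is a positive integer.  If it were at least two, then [F]
would reach the value [F x + 1] strictly inside the period, and [f] would not
be injective. *)
Lemma lift_exists (R : realType) (f : circle R -> circle R) :
  Diff2_plus f -> exists F, lift_of f F.
Proof.
move=> [_ [F [ctsF liftF] incrF] [g [fK gK] _]].
have leF : {mono F : x y / x <= y} by exact: le_mono.
have pi1 (x : R) : circle_pi (x + 1) = circle_pi x by apply/circle_piP; exists 1.
have F1 x : F (x + 1) = F x + 1.
  have /circle_piP[n Fn] : circle_pi (F (x + 1)) = circle_pi (F x) by rewrite -!liftF pi1.
  have x1 : x < x + 1 by lra.
  have n_gt0 : (0 < n)%R by move/incrF: x1; rewrite Fn ltrDl ltr0z.
  rewrite Fn; case: (ltgtP n 1) => [|n_gt1|-> //].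
    by rewrite -[X in _ < X]add0r ltzD1 leNgt n_gt0.
  have n2 : 1 < n%:~R :> R by rewrite -[1]/(1%:~R) ltr_int.
  have [||y] := @IVT R F x (x + 1) (F x + 1) (ltW x1).
  - exact: continuous_subspaceT.
  - by rewrite ge_min le_max Fn; apply/andP; split; apply/orP; [left|right]; lra.
  rewrite in_itv /= => /andP[xy yx] Fy.
  have /circle_piP[m ym] : circle_pi y = circle_pi x.
    by apply: (can_inj fK); rewrite !liftF Fy pi1.
  have xy' : x < y by rewrite ltNge -leF Fy; apply/negP; lra.
  have yx' : y < x + 1 by rewrite ltNge -leF Fy Fn; apply/negP; lra.
  have m_gt0 : (0 < m)%R by rewrite -(ltr_int R); lra.
  have : (m < 0 + 1)%R by rewrite add0r -(ltr_int R); lra.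
  by rewrite ltzD1 leNgt m_gt0.
exists F; split=> //.
have /choice[F' FF'] : forall y, exists x, F x = y.
  move=> y; have [x xy] := circle_pi_surj (g (circle_pi y)).
  have /circle_piP[n yn] : circle_pi y = circle_pi (F x) by rewrite -liftF xy gK.
  by exists (x + n%:~R); rewrite addr_intE.
by exists F'; split => // x; apply: (inc_inj leF); rewrite FF'.
Qed.

Lemma lift_monoid_lifts (R : realType) (T : set (circle R -> circle R)) :
  T `<=` @Diff2_plus R -> semigroup T ->
  (forall x : circle R, ~ finite_set (orbit_of T x)) -> lift_monoid (lifts T).
Proof.
move=> T_diff T_semi T_orb; split.
- by move=> F [f _ []].
- by move=> F [f _ []].
- by move=> F [f _ []].
- move=> n; exists id; first by right.
  split=> [x y|||x]; rewrite ?ltrD2r //.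
  + exists (fun x => x + (- n)%:~R).
    by split=> x; rewrite mulrNz ?addrK ?subrK.
  + by move=> x; rewrite addrAC.
  + by apply/esym/circle_piP; exists n.
- move=> F H [f Tf [incF [F' [FK F'K]] F1 fF]] [h Th [incH [H' [HK H'K]] H1 hH]].
  exists (f \o h).
    case: Tf => [Tf|->]; last by [].
    by case: Th => [Th|->]; left => //; exact: T_semi.
  split=> [x y xy||x|x] /=; first exact/incF/incH.
  + by exists (H' \o F'); split=> x /=; rewrite ?FK ?HK ?H'K ?F'K.
  + by rewrite H1 F1.
  + by rewrite hH fF.
move=> x finS; apply: (T_orb (circle_pi x)); apply: (sub_finite_set _ finS).
move=> _ [f Tf <-]; have [F liftF] := lift_exists (T_diff f Tf).
by exists F; [exists f => //; left | have [_ _ _ ->] := liftF].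
Qed.

Lemma lift_of_inverse (R : realType) (f g : circle R -> circle R) F G :
  inverse_of f g -> inverse_of F G -> lift_of f F -> lift_of g G.
Proof.
move=> [fK gK] [FK GK] [incF _ F1 fF]; have leF := le_mono incF; split.
- by move=> x y; rewrite -{1}(GK x) -{1}(GK y) (leW_mono leF).
- by exists F.
- by move=> x; apply: (inc_inj leF); rewrite F1 !GK.
- by move=> x; rewrite -{1}(GK x) -fF fK.
Qed.

Lemma inverse_lifts (R : realType) (T : set (circle R -> circle R)) :
  T `<=` @Diff2_plus R -> inverse_set (lifts T) = lifts (inverse_set T).
Proof.
move=> T_diff; apply/seteqP; split.
- move=> G [F [f Tf liftF] FG].
  have [g fg Tg] : exists2 g, inverse_of f g & inverse_set T g \/ g = id.
    case: Tf => [Tf|->]; last by exists id => //; right.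
    by have [_ _ [g fg _]] := T_diff f Tf; exists g => //; left; exists f.
  by exists g => //; exact: lift_of_inverse fg FG liftF.
move=> G [g Tg liftG]; have [_ [F [GK FK]] _ _] := liftG.
have [f gf Tf] : exists2 f, inverse_of g f & T f \/ f = id.
  by case: Tg => [[f Tf [fK gK]]|->]; [exists f => //; left | exists id => //; right].
exists F; last by [].
by exists f => //; apply: lift_of_inverse gf _ liftG.
Qed.

Definition liftable (R : realType) (T : set (circle R -> circle R)) :=
  forall f, T f -> exists F, lift_of f F.

Lemma liftable_inverse (R : realType) (T : set (circle R -> circle R)) :
  liftable T -> liftable (inverse_set T).
Proof.
move=> liftT g [f /liftT[F liftF] fg]; have [_ [G FG] _ _] := liftF.
by exists G; exact: lift_of_inverse fg FG liftF.
Qed.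

Lemma closed_invariant_lifts (R : realType) (T : set (circle R -> circle R)) K :
  liftable T ->
  closed_invariant (lifts T) (@circle_pi R @^-1` K) <-> closed_invariant T K.
Proof.
move=> liftT; split=> [[[x0 Kx0] clK KT]|[[p Kp] clK KT]]; split.
- by exists (circle_pi x0).
(* Openness in the quotient topology is openness of the inverse image. *)
- rewrite -[K]setCK; apply: open_closedC.
  by have := closed_openC clK.
- move=> f Tf _ [p Kp <-]; have [x xp] := circle_pi_surj p.
  have [F liftF] := liftT f Tf.
  rewrite -xp in Kp *; have [_ _ _ ->] := liftF.
  by apply: (KT F); [exists f => //; left | exists x].
- by have [x xp] := circle_pi_surj p; exists x; rewrite /= xp.
- by apply: preimage_closed clK => x _; exact: pi_continuous.
move=> F [f Tf [_ _ _ fF]] _ [x Kx <-]; rewrite /= -fF.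
by case: Tf => [Tf|-> //]; apply: (KT f Tf); exists (circle_pi x).
Qed.

Lemma closed_invariant_lifts_preimage (R : realType)
    (T : set (circle R -> circle R)) (C : set R) :
  lift_monoid (lifts T) -> closed_invariant (lifts T) C ->
  @circle_pi R @^-1` (@circle_pi R @` C) = C.
Proof.
move=> GG CG; apply/seteqP; split=> x; last by exists x.
by move=> [y Cy /esym/circle_piP[n ->]]; exact: closed_invariant_addr CG Cy.
Qed.

Lemma minimal_sets_lifts (R : realType) (T : set (circle R -> circle R)) :
  liftable T -> lift_monoid (lifts T) ->
  minimal_sets T #= minimal_sets (lifts T).
Proof.
move=> liftT GG; pose P (K : set (circle R)) := @circle_pi R @^-1` K.
have subP K L : P K `<=` P L -> K `<=` L.
  by move=> KL p; have [x <-] := circle_pi_surj p; exact: KL.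
have injP K L : P K = P L -> K = L.
  by move=> eqKL; apply/seteqP; split; apply: subP; rewrite eqKL.
have PE C : closed_invariant (lifts T) C -> exists2 K, closed_invariant T K & P K = C.
  move=> CG; have eqC := closed_invariant_lifts_preimage GG CG.
  exists (@circle_pi R @` C) => //.
  by apply/(closed_invariant_lifts _ liftT); rewrite eqC.
have -> : minimal_sets (lifts T) = P @` minimal_sets T.
  apply/seteqP; split=> [C [CG minC]|_ [K [KT minK] <-]].
    have [K KT PK] := PE C CG; exists K => //; split=> // L LT LK; apply: injP.
    rewrite PK; apply: minC; first exact/closed_invariant_lifts.
    by rewrite -PK => x /LK.
  split; first exact/closed_invariant_lifts.
  by move=> _ /PE[L LT <-] LK; rewrite (minK L) //; exact: subP.
rewrite card_eq_sym; apply: inj_card_eq => K L _ _; exact: injP.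
Qed.

Theorem theorem2p26 (R : realType) (T : set (circle R -> circle R))
    (T_diff : T `<=` @Diff2_plus R)
    (T_semigroup : semigroup T)
    (T_no_finite_orbit : forall x : circle R, ~ finite_set (orbit_of T x)) :
  minimal_sets (inverse_set T) #= minimal_sets T.
Proof.
have GG := lift_monoid_lifts T_diff T_semigroup T_no_finite_orbit.
have GG' := lift_monoid_inverse GG.
have liftT : liftable T by move=> f /T_diff/lift_exists.
have eqG := inverse_lifts T_diff; have liftT' := liftable_inverse liftT.
rewrite (card_eqr (minimal_sets_lifts liftT GG)).
rewrite (card_eql (minimal_sets_lifts liftT' _)) -eqG //.
rewrite card_eq_le (minimal_sets_le GG) andbT.
by have := minimal_sets_le GG'; rewrite (inverse_setK (lift_inv GG)).
Qed.
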